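(* There is a universal constant $C$ such that the following holds. For $j\in\{1,2\}$ let $A^1_j,\dots,A^n_j,B_j\in\mathrm{Sym}_k$, where $A^i_1\succeq0$ and $A^i_2\preceq 0$ for all $i$. Let $F:\{-1,1\}^n\to\{0,1\}$, $F(x)=\bigwedge_{j=1}^2\big[\sum_i x_iA^i_j\preceq B_j\big]$. Then $\mathsf{AS}(F)\le C\sqrt n$.
   Context: $\mathrm{Sym}_k$: real symmetric $k\times k$ matrices; $\preceq$: Löwner order. The average sensitivity of $F:\{-1,1\}^n\to\{0,1\}$ is $\mathsf{AS}(F)=\sum_{i=1}^n\Pr_{\boldsymbol{x}}[F(\boldsymbol{x})\ne F(\boldsymbol{x}^{(i)})]$ with $\boldsymbol{x}$ uniform and $\boldsymbol{x}^{(i)}$ obtained by flipping coordinate $i$. *)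

(* Defs.v *)
From mathcomp Require Import all_boot all_order all_algebra.
From mathcomp Require Import boolp reals.

Set Implicit Arguments.
Unset Strict Implicit.
Unset Printing Implicit Defensive.

Import Order.TTheory GRing.Theory Num.Theory.
Local Open Scope ring_scope.

(* The cube {-1,1}^n is encoded by bits: x stands for the sign vector with
   i-th coordinate (-1)^(x i). *)
Definition cube (n : nat) : finType := {ffun 'I_n -> bool}.

Definition cube_sign (R : pzRingType) (n : nat) (x : cube n) (i : 'I_n) : R :=
  (-1) ^+ x i.

Definition cube_flip (n : nat) (i : 'I_n) (x : cube n) : cube n :=
  [ffun l => if l == i then ~~ x l else x l].

Definition uniform_prob (R : fieldType) (n : nat) (E : pred (cube n)) : R :=
  #|[set x | E x]|%:R / #|cube n|%:R.

Definition avg_sens (R : fieldType) (n : nat) (F : cube n -> bool) : R :=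
  \sum_(i < n) uniform_prob R (fun x => F x != F (cube_flip i x)).

Definition psd (R : realFieldType) (k : nat) (M : 'M[R]_k) : Prop :=
  M \is symmetricmx /\ forall v : 'cV[R]_k, 0 <= (v^T *m M *m v) ord0 ord0.

Definition loewner_le (R : realFieldType) (k : nat) (M N : 'M[R]_k) : Prop :=
  psd (N - M).

Definition matrix_halfspace (R : realType) (n k : nat)
    (A : 'I_n -> 'M[R]_k) (B : 'M[R]_k) (x : cube n) : bool :=
  `[< loewner_le (\sum_(i < n) cube_sign R x i *: A i) B >].

(* Main.v *)
Require Import Defs.
From mathcomp Require Import all_boot all_order all_algebra.
From mathcomp Require Import boolp reals.
From mathcomp Require Import ring lra.

Import Order.TTheory GRing.Theory Num.Theory.
Local Open Scope ring_scope.

(** The first halfspace is antitone in the sign vector and the second one is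
    monotone, since raising a sign changes the matrix sum by [2 A]. A coordinate
    that is sensitive for the conjunction is sensitive for one of the two
    factors, so it suffices to bound the average sensitivity of a monotone
    [F]. With [G = (-1)^F], the influence of the coordinate [i] is the Fourier
    coefficient [E[x_i G(x)]], so the average sensitivity is
    [E[G(x) sum_i x_i] <= E|sum_i x_i| <= sqrt n]. The constant is [C = 2]. *)

Section CubeSums.
Variables (R : realType) (n : nat).
Implicit Types (x : cube n) (i j : 'I_n) (F : cube n -> bool).

Lemma cube_flipK i : involutive (@cube_flip n i).
Proof.
move=> x; apply/ffunP => l; rewrite !ffunE.
by case: eqP => // _; rewrite negbK.
Qed.

Lemma cube_sign_flip i j x :
  cube_sign R (cube_flip i x) j =
  if j == i then - cube_sign R x j else cube_sign R x j.
Proof.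
rewrite /cube_sign ffunE; case: eqP => // _.
by case: (x j); rewrite /= ?expr0 ?expr1 ?opprK.
Qed.

Lemma sqr_cube_sign x i : cube_sign R x i * cube_sign R x i = 1.
Proof. by rewrite /cube_sign -expr2 sqrr_sign. Qed.

Lemma sum_cube_flip i (h : cube n -> R) :
  \sum_x h x = \sum_x h (cube_flip i x).
Proof. exact: reindex_inj (inv_inj (cube_flipK i)). Qed.

(** Orthogonality of the degree-one characters: for distinct indices, flipping coordinate [i]
    negates every product, so the sum equals its own opposite. *)
Lemma sum_cube_signM i j :
  \sum_x cube_sign R x i * cube_sign R x j = (i == j)%:R * #|cube n|%:R.
Proof.
have [->|neq_ij] := eqVneq i j.
  by under eq_bigr do rewrite sqr_cube_sign; rewrite sumr_const mul1r.
rewrite mul0r; set S := LHS; suff : S = - S by lra.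
rewrite {1}/S (sum_cube_flip i) -sumrN; apply: eq_bigr => x _.
by rewrite !cube_sign_flip eqxx eq_sym (negPf neq_ij) mulNr.
Qed.

Lemma sum_sqr_cube_sign :
  \sum_(x : cube n) (\sum_i cube_sign R x i) ^+ 2 = n%:R * #|cube n|%:R.
Proof.
under eq_bigr do rewrite expr2 big_distrlr.
rewrite exchange_big /=.
under eq_bigr => i _.
  rewrite exchange_big /=; under eq_bigr do rewrite sum_cube_signM.
  rewrite (bigD1 i) //= eqxx mul1r big1 ?addr0; last first.
    by move=> j; rewrite eq_sym => /negPf ->; rewrite mul0r.
  over.
by rewrite sumr_const card_ord mulr_natl.
Qed.

(* The bit [true] encodes the sign [-1], so this is antitone in the signs. *)
Definition bit_monotone F :=
  forall i x, ~~ x i -> F x -> F (cube_flip i x).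

Lemma card_pred_sum (E : pred (cube n)) :
  #|[set x | E x]|%:R = \sum_x (E x)%:R :> R.
Proof.
rewrite -sum1dep_card natr_sum big_mkcond.
by apply: eq_bigr => x _; case: (E x).
Qed.

(** On an edge in direction [i] the two terms on the right cancel if [F] is constant there;
    otherwise monotonicity puts the value [true] at the end with sign -1, and each term is 1. *)
Lemma influence_bit_monotone F i : bit_monotone F ->
  \sum_x (F x != F (cube_flip i x))%:R =
  \sum_x cube_sign R x i * (-1) ^+ F x :> R.
Proof.
move=> monF; set S := RHS.
(* Doubling lets one copy of [S] be reindexed by the flip, so that both ends of an edge meet in a
   single summand. *)
suff : 2 * \sum_x (F x != F (cube_flip i x))%:R = S + S by lra.
rewrite {2}[S](sum_cube_flip i) -big_split mulr_sumr /=.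
apply: eq_bigr => x _; rewrite cube_sign_flip eqxx /cube_sign.
have up := monF i x; have := monF i (cube_flip i x).
rewrite cube_flipK ffunE eqxx negbK => down.
case: (x i) (F x) (F (cube_flip i x)) up down => [] [] [] up down /=;
  by [have := up isT isT | have := down isT isT | rewrite ?expr0 ?expr1; lra].
Qed.

Lemma avg_sens_bit_monotone F : bit_monotone F ->
  avg_sens R F <= Num.sqrt n%:R.
Proof.
move=> monF; have N_gt0 : 0 < #|cube n|%:R :> R.
  by rewrite ltr0n; apply/card_gt0P; exists [ffun=> false].
rewrite /avg_sens /uniform_prob -mulr_suml ler_pdivrMr //.
under eq_bigr => i _ do rewrite card_pred_sum influence_bit_monotone //.
rewrite exchange_big /=; under eq_bigr do rewrite -mulr_suml.
(* Cancelling the factor [2 * r] below needs [r] positive; for [n = 0] the inner sums of signs are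
   empty. *)
have [n0|n_gt0] := posnP n.
  rewrite big1 ?mulr_ge0 ?sqrtr_ge0 ?ler0n // => x _.
  by rewrite big1 ?mul0r // => i _; have := ltn_ord i; rewrite [X in (_ < X)%N]n0.
set r := Num.sqrt n%:R.
have r_gt0 : 0 < r by rewrite sqrtr_gt0 ltr0n.
have r2 : r * r = n%:R by rewrite -expr2 sqr_sqrtr ?ler0n.
rewrite -(ler_pM2l (mulr_gt0 (ltr0Sn R 1) r_gt0)).
(* AM-GM: [2 r t <= t ^+ 2 + r ^+ 2], summed over the cube *)
have -> : 2 * r * (r * #|cube n|%:R) =
    \sum_(x : cube n) ((\sum_i cube_sign R x i) ^+ 2 + n%:R).
  rewrite big_split sum_sqr_cube_sign sumr_const -[_ *+ _]mulr_natr -r2 /=.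
  ring.
rewrite mulr_sumr; apply: ler_sum => x _; rewrite -r2 -subr_ge0.
(* The factor [(-1) ^+ F x] squares to 1, so it survives only in the cross term of this square. *)
set t := \sum_i _; have := sqr_ge0 (t * (-1) ^+ F x - r).
by case: (F x); rewrite ?expr0 ?expr1; nra.
Qed.

(** This brings the second halfspace under the monotone bound, its complement being
    [bit_monotone]. *)
Lemma avg_sensN F : avg_sens R (fun x => ~~ F x) = avg_sens R F.
Proof.
apply: eq_bigr => i _; rewrite /uniform_prob; congr (_%:R / _).
by apply: eq_card => x; rewrite !inE (inj_eq negb_inj).
Qed.

Lemma avg_sens_andb F1 F2 :
  avg_sens R (fun x => F1 x && F2 x) <= avg_sens R F1 + avg_sens R F2.
Proof.
rewrite /avg_sens -big_split; apply: ler_sum => i _ /=.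
rewrite /uniform_prob -mulrDl ler_wpM2r ?invr_ge0 ?ler0n //.
rewrite !card_pred_sum -big_split; apply: ler_sum => x _ /=.
rewrite -natrD ler_nat.
by case: (F1 x) (F2 x) (F1 (_ i x)) (F2 (_ i x)) => [] [] [] [].
Qed.

End CubeSums.

Section MatrixHalfspaces.
Variables (R : realType) (n k : nat).
Implicit Types (A : 'I_n -> 'M[R]_k) (B M N : 'M[R]_k).

Lemma psdD M N : psd M -> psd N -> psd (M + N).
Proof.
move=> [symM posM] [symN posN]; split=> [|v].
  move: symM symN; rewrite !is_hermitianmxE !scale1r.
  by rewrite linearD map_mxD => /eqP {1}-> /eqP {1}->.
by rewrite mulmxDr mulmxDl mxE addr_ge0.
Qed.

Lemma sum_cube_sign_flip A i (x : cube n) :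
  \sum_j cube_sign R (cube_flip i x) j *: A j =
  \sum_j cube_sign R x j *: A j - (cube_sign R x i *: A i) *+ 2.
Proof.
rewrite (bigD1 i) // [in RHS](bigD1 i) //= cube_sign_flip eqxx scaleNr.
under eq_bigr => j /negPf ij do rewrite cube_sign_flip ij.
by rewrite mulr2n opprD addrACA subrr add0r addrC.
Qed.

(** The flip adds [cube_sign R x i *: A i] twice to the slack between the sum and [B], and a sum of
    psd matrices is psd. *)
Lemma matrix_halfspace_flip A B i (x : cube n) :
  psd (cube_sign R x i *: A i) ->
  matrix_halfspace A B x -> matrix_halfspace A B (cube_flip i x).
Proof.
move=> psdA /asboolP psdx; apply/asboolP.
rewrite /loewner_le sum_cube_sign_flip opprB addrCA addrC mulr2n.
exact: psdD psdx (psdD _ _ psdA psdA).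
Qed.

Lemma matrix_halfspace_bit_monotone A B :
  (forall i, loewner_le 0 (A i)) -> bit_monotone n (matrix_halfspace A B).
Proof.
move=> posA i x /negPf xi; apply: matrix_halfspace_flip.
by have := posA i; rewrite /loewner_le subr0 /cube_sign xi expr0 scale1r.
Qed.

Lemma matrix_halfspace_bit_antitone A B :
  (forall i, loewner_le (A i) 0) ->
  bit_monotone n (fun x => ~~ matrix_halfspace A B x).
Proof.
move=> negA i x xi; apply: contra => Fx.
(* The flip starts at the neighbour of [x], where coordinate [i] has sign -1 and [- A i] is psd, and
   leads back to [x]. *)
rewrite -(cube_flipK n i x); apply: matrix_halfspace_flip Fx.
have := negA i; rewrite /loewner_le sub0r /cube_sign ffunE eqxx xi.
by rewrite expr1 scaleN1r.
Qed.

End MatrixHalfspaces.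

Theorem theorem5p2 (R : realType) :
  exists C : R,
    forall (n k : nat) (A1 A2 : 'I_n -> 'M[R]_k) (B1 B2 : 'M[R]_k),
      (forall i, A1 i \is symmetricmx) ->
      (forall i, A2 i \is symmetricmx) ->
      B1 \is symmetricmx ->
      B2 \is symmetricmx ->
      (forall i, loewner_le 0 (A1 i)) ->
      (forall i, loewner_le (A2 i) 0) ->
      avg_sens R (fun x => matrix_halfspace A1 B1 x && matrix_halfspace A2 B2 x)
        <= C * Num.sqrt n%:R.
Proof.
exists 2 => n k A1 A2 B1 B2 _ _ _ _ posA1 negA2.
apply: le_trans (avg_sens_andb _ _ _ _) _; rewrite mulr_natl mulr2n.
apply: lerD; last rewrite -avg_sensN; apply: avg_sens_bit_monotone.
  exact: matrix_halfspace_bit_monotone.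
exact: matrix_halfspace_bit_antitone.
Qed.
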